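(* Let $X$ be a (connected) simply laced Dynkin diagram with vertex set $[n]=\{1,\dots,n\}$ corresponding to the root system $\Phi$. For each assignment $\gamma:[n]\to\mathbb{Z}_{\geq 0}$ define the corresponding dominant weight $\lambda(\gamma):=\sum_{i=1}^n \gamma(i)\omega_i$. Then: (i) An assignment $\gamma':[n]\to\mathbb{Z}_{\ge 0}$ is obtained from $\gamma$ by a UCF move if and only if $W.\lambda(\gamma) \to W.\lambda(\gamma')$ in unlabeled central-firing. (ii) UCF moves always commute. More precisely, let $R_1$ and $R_2$ be two distinct zero connected components of $\gamma$, and let $\gamma'_1$ (resp., $\gamma'_2$) be the assignment obtained from $\gamma$ by a UCF move along $R_1$ (resp., along $R_2$). Then $\gamma'_1$ has a zero connected component $R'_2\supseteq R_2$, $\gamma'_2$ has a zero connected component $R'_1\supseteq R_1$, and applying a UCF move to $\gamma'_1$ along $R'_2$ produces the same result as applying a UCF move to $\gamma'_2$ along $R'_1$.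
   Context: $\Phi$ is an irreducible, reduced, crystallographic, simply laced root system (all roots of the same length) spanning a real inner product space $(V,\langle\cdot,\cdot\rangle)$ of dimension $n$, with simple roots $\alpha_1,\dots,\alpha_n$, positive roots $\Phi^+$, coroots $\alpha^\vee=2\alpha/\langle\alpha,\alpha\rangle$ and Weyl group $W$. Its Dynkin diagram $X$ is the graph on $[n]$ in which $i\ne j$ are joined by a single edge if and only if $\langle\alpha_i,\alpha_j^\vee\rangle=-1$ (otherwise $\langle\alpha_i,\alpha_j^\vee\rangle=0$). The weight lattice is $P=\{u\in V:\langle u,\alpha^\vee\rangle\in\mathbb{Z}\ \forall\alpha\in\Phi\}$, and the fundamental weights $\omega_i$ are defined by $\langle\omega_i,\alpha_j^\vee\rangle=\delta_{i,j}$. Central-firing is the relation on $P$ given by $\lambda\to\lambda+\alpha$ whenever $\alpha\in\Phi^+$ and $\langle\lambda,\alpha^\vee\rangle=0$. Unlabeled central-firing is the induced relation on $P/W$: $W.\lambda\to W.\mu$ iff there are $\lambda'\in W.\lambda$, $\mu'\in W.\mu$ with $\lambda'\to\mu'$. Affine completion. To each connected simply laced Dynkin diagram $R$ one associates its affine Dynkin diagram $\widetilde R$, with vertex set $R\cup\{0\}$ and containing $R$ as the induced subgraph on the vertices of $R$; with Bourbaki's numbering of $R$, the extra vertex $0$ is joined: by two edges to the unique vertex for type $A_1$; by one edge to each of the two end vertices for type $A_m$, $m\geq2$; by one edge to vertex $2$ for type $D_m$, $m\ge4$ (the neighbor of the leaf $1$ of the long arm; the central vertex for $D_4$); by one edge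 to vertex $2$ for $E_6$ (the leaf adjacent to the trivalent vertex); by one edge to vertex $1$ for $E_7$ (the leaf at the end of the arm of length two); by one edge to vertex $8$ for $E_8$ (the leaf at the end of the longest arm). Equivalently, the number of edges between $0$ and $i\in R$ is $\langle\theta_R,\alpha_i^\vee\rangle$, where $\theta_R$ is the highest root of the root system of $R$. UCF moves. Let $\gamma:[n]\to\mathbb{Z}_{\ge0}$. A zero connected component of $\gamma$ is a connected component of the induced subgraph of $X$ on $\{i\in[n]:\gamma(i)=0\}$. An unlabeled central-firing move (UCF move) along $R$ consists of: (1) choosing a zero connected component $R$ of $\gamma$; (2) completing $R$ to its affine Dynkin diagram $\widetilde R$ with vertex set $R\cup\{0\}$; (3) for every edge $\{0,i\}$ of $\widetilde R$ (counted with multiplicity), increasing $\gamma(i)$ by $1$; (4) for every vertex $j\notin R$ that is adjacent in $X$ to a vertex of $R$, decreasing $\gamma(j)$ by $1$. The resulting assignment is said to be obtained from $\gamma$ via a UCF move along $R$. *)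

(* Defs.v *)
From HB Require Import structures.
From mathcomp Require Import all_boot all_order all_algebra.
From mathcomp Require Import finmap sesquilinear.
From mathcomp Require Import all_classical reals.
Set Implicit Arguments.
Unset Strict Implicit.
Unset Printing Implicit Defensive.
Import Order.TTheory GRing.Theory Num.Theory.
Local Open Scope ring_scope.
Local Open Scope classical_set_scope.

(* In this file [{dot V for idfun}] is a real inner product on V: a bilinear,
   symmetric, positive definite form. *)

Section RootSystems.
Variables (R : realType) (V : vectType R) (ip : {dot V for idfun}).

Definition coroot (a : V) : V := (2 / ip a a) *: a.

Definition reflection (a v : V) : V := v - ip v (coroot a) *: a.

Section Roots.
Variable Phi : {fset V}.

Record root_system : Prop := RootSystem {
  root_neq0 : 0 \notin Phi;
  root_span : (<<enum_fset Phi>> = fullv)%VS;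
  root_reflection : {in Phi &, forall a b, reflection a b \in Phi};
  root_crystallographic :
    {in Phi &, forall a b, ip b (coroot a) \is a Num.int};
  root_reduced :
    forall (a : V) (c : R), a \in Phi -> c *: a \in Phi -> c = 1 \/ c = -1
}.

Definition irreducible_roots : Prop :=
  Phi != fset0 /\
  forall P : pred V,
    (exists2 a, a \in Phi & P a) -> (exists2 b, b \in Phi & ~~ P b) ->
    exists a b, [/\ a \in Phi, b \in Phi, P a, ~~ P b & ip a b != 0].

Definition simply_laced : Prop := {in Phi &, forall a b, ip a a = ip b b}.

Definition weight (v : V) : Prop :=
  {in Phi, forall a, ip v (coroot a) \is a Num.int}.

(* W consists of all products of reflections in roots; as reflections are
   involutions, this is the group they generate. *)
Definition weyl_element (w : V -> V) : Prop :=
  exists2 s : seq V, {subset s <= Phi}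
    & w = foldr (fun a f => reflection a \o f) id s.

Definition weyl_orbit (v : V) : set V :=
  [set u | exists2 w, weyl_element w & u = w v].

Section SimpleRoots.
Variables (n : nat) (alpha : 'I_n -> V).

Definition nonneg_comb (v : V) : Prop :=
  exists c : 'I_n -> nat, v = \sum_(i < n) alpha i *+ c i.

Record simple_roots : Prop := SimpleRoots {
  simple_in : forall i, alpha i \in Phi;
  simple_basis : basis_of fullv (codom alpha);
  simple_sign : {in Phi, forall b, nonneg_comb b \/ nonneg_comb (- b)}
}.

Definition positive_root (b : V) : Prop := b \in Phi /\ nonneg_comb b.

Definition fundamental_weights (omega : 'I_n -> V) : Prop :=
  forall i j, ip (omega i) (coroot (alpha j)) = (i == j)%:R.

Definition dynkin_diagram : rel 'I_n :=
  fun i j => (i != j) && (ip (alpha i) (coroot (alpha j)) == -1).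

Definition central_firing (u v : V) : Prop :=
  [/\ weight u, weight v
    & exists a, [/\ positive_root a, ip u (coroot a) = 0 & v = u + a]].

(* The elements of P/W are the orbits [weyl_orbit u] of weights u. *)
Definition unlabeled_central_firing (A B : set V) : Prop :=
  exists u v, [/\ A u, B v & central_firing u v].

End SimpleRoots.
End Roots.
End RootSystems.

(* The connected simply laced Dynkin diagrams with m vertices, in Bourbaki's
   numbering by 1, ..., m. *)
Inductive dynkin_type := TypeA | TypeD | TypeE.

Definition dynkin_rank (T : dynkin_type) (m : nat) : bool :=
  match T with
  | TypeA => 1 <= m
  | TypeD => 4 <= m
  | TypeE => 6 <= m <= 8
  end%N.

(* The edges {i, j} with i < j. *)
Definition bourbaki_edge (T : dynkin_type) (m i j : nat) : bool :=
  match T with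
  | TypeA => j == i.+1
  | TypeD => (j == i.+1) && (j < m) || (i.+2 == m) && (j == m)
  | TypeE => [|| (i == 1) && (j == 3), (i == 2) && (j == 4)
               | (3 <= i) && (j == i.+1)]
  end%N.

Definition bourbaki_adj (T : dynkin_type) (m i j : nat) : bool :=
  bourbaki_edge T m i j || bourbaki_edge T m j i.

(* The number of edges between the extra vertex 0 of the affine diagram and the
   vertex i; in type A_1 both summands count. *)
Definition affine_edges (T : dynkin_type) (m i : nat) : nat :=
  match T with
  | TypeA => (i == 1) + (i == m)
  | TypeD => i == 2
  | TypeE => i == (if m == 6 then 2 else if m == 7 then 1 else 8)
  end%N.

Section UCF.
Variables (n : nat) (X : rel 'I_n).

(* b restricts to an isomorphism from the subgraph of X induced on R to the
   diagram of type T with #|R| vertices. *)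
Definition bourbaki_numbering (R : {set 'I_n}) (T : dynkin_type)
    (b : 'I_n -> nat) : Prop :=
  [/\ dynkin_rank T #|R|,
      perm_eq [seq b i | i <- enum R] (iota 1 #|R|)
    & {in R &, forall i j, X i j = bourbaki_adj T #|R| (b i) (b j)}].

(* e i is the number of edges between 0 and i in the affine completion of R. *)
Definition affine_completion (R : {set 'I_n}) (e : 'I_n -> nat) : Prop :=
  exists T b, bourbaki_numbering R T b /\
    forall i, e i = if i \in R then affine_edges T #|R| (b i) else 0%N.

Definition zero_adj (g : {ffun 'I_n -> nat}) : rel 'I_n :=
  fun i j => [&& g i == 0, g j == 0 & X i j]%N.

Definition zero_component (g : {ffun 'I_n -> nat}) (R : {set 'I_n}) : Prop :=
  exists2 i, g i = 0%N & R = [set j | connect (zero_adj g) i j]%SET.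

(* The decrease is written on the left-hand side to avoid the truncated
   subtraction of nat. *)
Definition ucf_move (g : {ffun 'I_n -> nat}) (R : {set 'I_n})
    (g' : {ffun 'I_n -> nat}) : Prop :=
  zero_component g R /\
  exists2 e, affine_completion R e
    & forall j, (g' j + ((j \notin R) && [exists i in R, X i j])
                 = g j + e j)%N.

End UCF.

(* Main.v *)
Require Import Defs.
From HB Require Import structures.
From mathcomp Require Import all_boot all_order all_algebra.
From mathcomp Require Import finmap sesquilinear.
From mathcomp Require Import all_classical reals.
From mathcomp Require Import zify lra.
Set Implicit Arguments.
Unset Strict Implicit.
Unset Printing Implicit Defensive.
Import Order.TTheory GRing.Theory Num.Theory.
Local Open Scope ring_scope.

(** Write (-,-) for the inner product scaled so that roots have norm 2, and
    let S be a zero component of g, with highest root theta_S. Then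
    lambda(g) + theta_S is dominant, and it is lambda(g') for the assignment g'
    given by the UCF move along S. Conversely, a root orthogonal to lambda(g)
    can be moved, by simple reflections fixing lambda(g), up to theta_S for a
    zero component S containing its support. Since a W-orbit contains only one
    dominant weight, this yields (i). It also yields (ii): the weight
    lambda(g) + theta_1 + theta_2 is fired from both lambda(g1) and
    lambda(g2), so the dominant weight in its orbit is the result of a UCF move
    on either side.

    The affine completion of S involves Bourbaki's numbering of S, so the
    classification is needed. It is obtained by growing a numbered subdiagram
    by adjacent vertices v one at a time. If theta is the highest root of the
    subdiagram, then (theta + alpha_v, theta + alpha_v) > 0 says that the marks
    of the neighbours of v add up to at most 1: v is joined to a single vertex,
    and that vertex has mark 1. *)

(** * Attaching a vertex to a Dynkin diagram *)

Section Marks.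
Local Open Scope nat_scope.

(* The coefficients of the highest root. *)
Definition mark (T : dynkin_type) (m k : nat) : nat :=
  match T with
  | TypeA => 1
  | TypeD => if (k == 1) || (m <= k.+1) then 1 else 2
  | TypeE => nth 0 (if m == 6 then [:: 1; 2; 2; 3; 2; 1]
                    else if m == 7 then [:: 2; 2; 3; 4; 3; 2; 1]
                    else [:: 2; 3; 4; 6; 5; 4; 3; 2]) k.-1
  end.

Lemma muln_bool (k : nat) (b : bool) : k * b = if b then k else 0.
Proof. by case: b; rewrite ?muln1 ?muln0. Qed.

Lemma sum_mul_eq (F : nat -> nat) (m a : nat) (P : bool) :
  \sum_(1 <= j < m.+1) F j * ((j == a) && P)
  = if [&& 0 < a, a <= m & P] then F a else 0.
Proof.
case: P; last first.
  by rewrite !andbF big1 // => j _; rewrite andbF muln0.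
under eq_bigr => j _ do rewrite andbT muln_bool.
by rewrite -big_mkcond big_nat1_eq ltnS andbT; case: ifP.
Qed.

Lemma mark_gt0 T m k : dynkin_rank T m -> 0 < k <= m -> 0 < mark T m k.
Proof.
case: T => //=; first by case: ifP.
move=> mr; have [->|[->|->]] : m = 6 \/ m = 7 \/ m = 8 by lia.
all: by do 9 (case: k => [|k] //).
Qed.

Lemma bourbaki_edge_lt T m i j : dynkin_rank T m -> bourbaki_edge T m i j -> i < j.
Proof. by case: T => /=; lia. Qed.

Lemma bourbaki_adjE T m i j : dynkin_rank T m ->
  bourbaki_adj T m i j = bourbaki_edge T m i j + bourbaki_edge T m j i :> nat.
Proof.
move=> mr; rewrite /bourbaki_adj.
have := @bourbaki_edge_lt T m i j mr; have := @bourbaki_edge_lt T m j i mr.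
by case: bourbaki_edge; case: bourbaki_edge => // /(_ isT) ? /(_ isT); lia.
Qed.

(** With coefficient 1 at the extra vertex, the marks form a null vector of the affine Cartan
    matrix; this is the row of [k]. In types A and D the neighbours of [k] are listed by indicators;
    type E is computed. *)
Lemma sum_mark_adj T m k : dynkin_rank T m -> 0 < k <= m ->
  \sum_(1 <= j < m.+1) mark T m j * bourbaki_adj T m j k + affine_edges T m k
  = 2 * mark T m k.
Proof.
case: T => mr km; under eq_bigr do rewrite bourbaki_adjE //.
- rewrite (@eq_big_nat _ _ _ _ _ _ (fun j =>
    1 * ((j == k.-1) && (1 < k)) + 1 * ((j == k.+1) && true))); last first.
    by move=> j jm /=; lia.
  by rewrite big_split /= !sum_mul_eq; do 2!case: ifP => ?; lia.
- have edgekE j : 0 < j -> bourbaki_edge TypeD m j k =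
      ((j == k.-1) && ((1 < k) && (k < m))) + ((j == m.-2) && (k == m)) :> nat.
    by move: mr => /=; lia.
  have edgeEk j : 0 < j -> bourbaki_edge TypeD m k j =
      ((j == k.+1) && (k.+1 < m)) + ((j == m) && (k == m.-2)) :> nat.
    by move: mr => /=; lia.
  under eq_big_nat => j /andP[j0 _] do rewrite edgekE // edgeEk // !mulnDr.
  rewrite !big_split /= !sum_mul_eq /mark /affine_edges;
    clear edgekE edgeEk; rewrite /= in mr.
  have kcase : k = 1 \/ 1 < k < m.-2 \/ k = m.-2 \/ k = m.-1 \/ k = m by lia.
  by case: kcase => [?|[?|[?|[?|?]]]];
    do ?(case: ifP => ?; try by exfalso; lia); lia.
- rewrite unlock; suff : all (fun k => reducebig 0 (index_iota 1 m.+1)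
      (fun j => BigBody j addn true (mark TypeE m j *
         (bourbaki_edge TypeE m j k + bourbaki_edge TypeE m k j)))
      + affine_edges TypeE m k == 2 * mark TypeE m k) (iota 1 m).
    by move/allP/(_ k); rewrite mem_iota add1n ltnS => /(_ km)/eqP.
  have m678 : [|| m == 6, m == 7 | m == 8] by move: mr => /=; lia.
  by case/or3P: m678 => /eqP ->; vm_compute.
Qed.

(** The row of the extra vertex in the same null vector; it will give the highest root squared norm
    2. *)
Lemma sum_mark_affine T m : dynkin_rank T m ->
  \sum_(1 <= k < m.+1) mark T m k * affine_edges T m k = 2.
Proof.
case: T => mr; rewrite /dynkin_rank in mr.
- rewrite (eq_bigr (fun k => 1 * ((k == 1) && true) + 1 * ((k == m) && true))).
    by rewrite big_split /= !sum_mul_eq; do 2!case: ifP => ?; lia.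
  by move=> k _ /=; lia.
- rewrite (eq_bigr (fun k => 2 * ((k == 2) && true))).
    by rewrite sum_mul_eq; case: ifP => ?; lia.
  by move=> k _ /=; case: eqP => [->|]; rewrite ?muln0 //=; case: ifP; lia.
- rewrite unlock; have m678 : [|| m == 6, m == 7 | m == 8] by lia.
  by case/or3P: m678 => /eqP ->; vm_compute.
Qed.

End Marks.

Section Attach.
Local Open Scope nat_scope.

(* The diagram of type T with m vertices, with one more vertex, numbered 0 and
   joined to the vertex a only. *)
Definition attach (T : dynkin_type) (m a i j : nat) : bool :=
  if i == 0 then j == a else if j == 0 then i == a else bourbaki_adj T m i j.

Definition embeds (T : dynkin_type) (m a : nat) (T' : dynkin_type) (M : nat)
    (rho : nat -> nat) : Prop :=
  [/\ dynkin_rank T' M,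
      forall i, 0 < i <= M -> rho i <= m,
      {in [pred i | 0 < i <= M] &, injective rho}
    & forall i j, 0 < i <= M -> 0 < j <= M ->
        attach T m a (rho i) (rho j) = bourbaki_adj T' M i j].

Lemma bourbaki_adj_sym T m : symmetric (bourbaki_adj T m).
Proof. by move=> i j; rewrite /bourbaki_adj orbC. Qed.

Lemma bourbaki_adj_irr T m i : dynkin_rank T m -> bourbaki_adj T m i i = false.
Proof.
move=> mr; apply/negP; rewrite /bourbaki_adj orbb.
by move=> /(bourbaki_edge_lt mr); rewrite ltnn.
Qed.

Lemma attach_sym T m a : 0 < a -> symmetric (attach T m a).
Proof.
move=> a0 i j; rewrite /attach bourbaki_adj_sym.
by case: (i =P 0) => i0; case: (j =P 0) => j0; rewrite ?i0 ?j0.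
Qed.

Lemma attach_irr T m a i : dynkin_rank T m -> 0 < a -> attach T m a i i = false.
Proof.
move=> mr a0; rewrite /attach; case: (i =P 0) => [->|_]; first by case: a a0.
exact: bourbaki_adj_irr.
Qed.

(** Adjacency is symmetric and irreflexive, and a Bourbaki edge goes from the smaller label to the
    larger, so pairs [i < j] suffice. *)
Lemma embedsI T m a T' M rho : dynkin_rank T m -> 0 < a -> dynkin_rank T' M ->
  (forall i, 0 < i <= M -> rho i <= m) ->
  (forall i j, 0 < i -> i < j -> j <= M ->
     rho i <> rho j /\ attach T m a (rho i) (rho j) = bourbaki_edge T' M i j) ->
  embeds T m a T' M rho.
Proof.
move=> mr a0 Mr rhom rhoP; split=> // [i j|i j] /andP[i0 iM] /andP[j0 jM].
  have [ij|ij|//] := ltngtP i j.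
  - by have [neq _] := rhoP i j i0 ij jM => /neq.
  - by have [neq _] := rhoP j i j0 ij iM => /esym/neq.
have edgeF k l : k < l -> bourbaki_edge T' M l k = false.
  by move=> kl; apply/negP => /(bourbaki_edge_lt Mr); rewrite ltnNge ltnW.
rewrite /bourbaki_adj; have [ij|ij|<-] := ltngtP i j.
- by have [_ ->] := rhoP i j i0 ij jM; rewrite (edgeF i j) // orbF.
- by have [_] := rhoP j i j0 ij iM; rewrite attach_sym // => ->; rewrite (edgeF j i).
- rewrite attach_irr // orbb; apply/esym/negP => /(bourbaki_edge_lt Mr).
  by rewrite ltnn.
Qed.

(* The witnesses form a subdiagram of type E and a further vertex x joined to a
   vertex y of mark at least 2; such a diagram is not positive definite. *)
Definition overextended T m a : Prop :=
  exists M rho x y, [/\ embeds T m a TypeE M rho, x <= m,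
    forall i, 0 < i <= M -> rho i <> x,
    0 < y <= M /\ attach T m a x (rho y) & 1 < mark TypeE M y].

Ltac eq_cases :=
  repeat match goal with
    |- context [if (?x == ?y) then _ else _] => is_var x; case: (x =P y) => ?
  end.

Ltac embed_tac :=
  apply: embedsI; [rewrite /=; lia | lia | rewrite /=; lia
  | move=> i im; eq_cases; lia
  | move=> i j i0 ij jm; split; [eq_cases; lia|]; eq_cases;
    rewrite /attach /bourbaki_adj /bourbaki_edge /=;
    do ?(case: ifP => ?; try by exfalso; lia); lia].

Ltac overextended_tac :=
  split; [embed_tac | lia | move=> i i8; eq_cases; lia | split;
    [by [] | rewrite /attach /bourbaki_adj /bourbaki_edge /=;
      do ?(case: ifP => ?; try by exfalso; lia); lia] | by []].

(** An end vertex gives type A, the next one type D, the third one type E up to [m = 7]. Beyond that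
    the diagram contains affine E_8, and for any other [a] affine E_7. In the E cases [a] becomes
    the trivalent vertex 4 and the new vertex the short arm 2. *)
Lemma attach_A m a : 0 < a <= m ->
  (exists T rho, embeds TypeA m a T m.+1 rho) \/ overextended TypeA m a.
Proof.
move=> am; have [a1|a1] := eqVneq a 1.
  by left; exists TypeA, predn; embed_tac.
have [am'|am'] := eqVneq a m.
  by left; exists TypeA, (fun k => if k == m.+1 then 0 else k); embed_tac.
have [a2|a2] := eqVneq a 2.
  by left; exists TypeD, (fun k => m.+1 - k); embed_tac.
have [am1|am1] := eqVneq a m.-1.
  by left; exists TypeD, (fun k => if k == m.+1 then 0 else k); embed_tac.
have [a3|a3] := eqVneq a 3.
  pose rho k := if k == 2 then 0 else if k == 1 then 1 else k.-1.
  have [m7|m7] := leqP m 7.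
    by left; exists TypeE, rho; rewrite /rho; embed_tac.
  right; exists 8, rho, 8, 8; rewrite /rho.
  by overextended_tac.
have [am2|am2] := eqVneq a m.-2.
  pose rho k := if k == 2 then 0 else if k == 1 then m else m.+2 - k.
  have [m7|m7] := leqP m 7.
    by left; exists TypeE, rho; rewrite /rho; embed_tac.
  right; exists 8, rho, (m - 7), 8; rewrite /rho.
  by overextended_tac.
right; exists 7, (fun k => if k == 2 then 0 else if k == 1 then a.-2 else a + k - 4).
exists (a - 3), 1.
by overextended_tac.
Qed.

(** A decidable form, checked by computation on small diagrams; [s] lists the images of 1, 2, ...,
    so label [k] sits at position [k.-1]. *)
Definition embeds_seq T m a T' (s : seq nat) : bool :=
  [&& dynkin_rank T m, 0 < a, dynkin_rank T' m.+1
    & all (fun i => (nth 0 s i.-1 <= m) &&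
        all (fun j => (i < j) ==> (nth 0 s i.-1 != nth 0 s j.-1) &&
          (attach T m a (nth 0 s i.-1) (nth 0 s j.-1)
           == bourbaki_edge T' m.+1 i j)) (iota 1 m.+1)) (iota 1 m.+1)].

Lemma embeds_seqP T m a T' s : embeds_seq T m a T' s ->
  embeds T m a T' m.+1 (fun k => nth 0 s k.-1).
Proof.
case/and4P=> mr a0 Mr /allP s_ok.
have in_iota i : 0 < i -> i <= m.+1 -> i \in iota 1 m.+1.
  by move=> *; rewrite mem_iota; lia.
apply: embedsI => // [i /andP[i0 im]|i j i0 ij jm].
  by have /s_ok/andP[] := in_iota i i0 im.
have /s_ok/andP[_ /allP j_ok] := in_iota i i0 (ltnW (leq_trans ij jm)).
have /j_ok := in_iota j (ltn_trans i0 ij) jm.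
by rewrite ij => /andP[/eqP ? /eqP].
Qed.

(** Mark 1 leaves the end of the long arm, which gives type D again, and the two short leaves, which
    give type E for [4 < m <= 7] and otherwise a diagram containing affine E_8. *)
Lemma attach_D m a : 3 < m -> 0 < a <= m -> mark TypeD m a = 1 ->
  (exists T rho, embeds TypeD m a T m.+1 rho) \/ overextended TypeD m a.
Proof.
move=> m4 am; have [a1 _|a1] := eqVneq a 1.
  by left; exists TypeD, predn; embed_tac.
rewrite /mark (negPf a1) /=; case: ifP => // am1 _.
have [m4'|m4'] := eqVneq m 4.
  (* By triality the short leaves of D_4 also give D_5: the chain is [0], [a], 2, 1, and [7 - a] is
     the remaining leaf. *)
  left; exists TypeD, (fun k => nth 0 [:: 0; a; 2; 1; 7 - a] k.-1); subst m.
  by apply: embeds_seqP; have [->|->] : a = 3 \/ a = 4 by lia.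
have am2 : a = m.-1 \/ a = m by lia.
pose rho k := if k == 1 then 0 else if k == 2 then 2 * m - a.+1
  else if k == 3 then a else m.+2 - k.
have [m7|m7] := leqP m 7.
  left; exists TypeE, rho; rewrite /rho; clear rho.
  by case: am2 => ?; subst a; embed_tac.
right; exists 8, rho, (m - 7), 8; rewrite /rho; clear rho.
by case: am2 => ?; subst a; overextended_tac.
Qed.

(** Mark 1 occurs at the two long-arm ends of E_6, giving E_7, and at vertex 7 of E_7, giving E_8;
    E_8 has no such vertex. *)
Lemma attach_E m a : 5 < m <= 8 -> 0 < a <= m -> mark TypeE m a = 1 ->
  exists rho, embeds TypeE m a TypeE m.+1 rho.
Proof.
move=> m68 am ma.
have : [|| (m == 6) && (a == 1), (m == 6) && (a == 6) | (m == 7) && (a == 7)].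
  have m678 : [|| m == 6, m == 7 | m == 8] by lia.
  by case/or3P: m678 am ma => /eqP -> {m m68}; do 9 (case: a => [|a] //).
case/or3P=> /andP[/eqP -> /eqP ->].
- by exists (fun k => nth 0 [:: 6; 2; 5; 4; 3; 1; 0] k.-1); apply: embeds_seqP.
- by exists (fun k => nth 0 [:: 1; 2; 3; 4; 5; 6; 0] k.-1); apply: embeds_seqP.
- by exists (fun k => nth 0 [:: 1; 2; 3; 4; 5; 6; 7; 0] k.-1); apply: embeds_seqP.
Qed.

Lemma attach_mark1 T m a : dynkin_rank T m -> 0 < a <= m -> mark T m a = 1 ->
  (exists T' rho, embeds T m a T' m.+1 rho) \/ overextended T m a.
Proof.
case: T => mr am ma; first exact: attach_A.
  exact: attach_D.
by left; have [rho ?] := attach_E mr am ma; exists TypeE, rho.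
Qed.

End Attach.

(** * Numbering connected subdiagrams *)

Section Numbering.
Variables (n : nat) (X : rel 'I_n).
Hypotheses (X_sym : symmetric X) (X_irr : irreflexive X).
Local Open Scope nat_scope.

(** Here [f] goes from labels to vertices, opposite to [bourbaki_numbering]; its values outside 1,
    ..., [m] are arbitrary. *)
Definition numbered (T : dynkin_type) (m : nat) (f : nat -> 'I_n) : Prop :=
  [/\ dynkin_rank T m,
      {in [pred i | 0 < i <= m] &, injective f}
    & forall i j, 0 < i <= m -> 0 < j <= m ->
        X (f i) (f j) = bourbaki_adj T m i j].

(** The trace of positive definiteness that the classification uses, which keeps this section purely
    combinatorial. *)
Definition mark_bound : Prop :=
  forall T m f v, numbered T m f -> v \notin map f (iota 1 m) ->
    \sum_(1 <= k < m.+1) mark T m k * X v (f k) <= 1.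

Lemma mem_map_iota1 (f : nat -> 'I_n) m v :
  reflect (exists2 k, 0 < k <= m & v = f k) (v \in map f (iota 1 m)).
Proof.
by apply: (iffP mapP) => -[k km ->]; exists k; move: km; rewrite ?mem_iota ?add1n.
Qed.

(** The label of a vertex is its position in the list of values of [f], plus one. *)
Lemma numbered_bourbaki T (S : {set 'I_n}) f :
  numbered T #|S| f -> S =i map f (iota 1 #|S|) ->
  exists b, bourbaki_numbering X S T b.
Proof.
move=> [mr finj fX] Sf; set s := map f (iota 1 #|S|).
have s_uniq : uniq s.
  rewrite map_inj_in_uniq ?iota_uniq // => i j.
  by rewrite !mem_iota add1n => i_in j_in; apply: finj.
have bK i : i \in S -> f (index i s).+1 = i /\ index i s < #|S|.
  rewrite Sf => is_; have ls : index i s < #|S|.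
    by rewrite -[X in _ < X](size_iota 1) -(size_map f) index_mem.
  split=> //; rewrite -[RHS](nth_index i is_) (nth_map 0) ?size_iota //.
  by rewrite nth_iota.
exists (fun i => (index i s).+1); split=> //; last first.
  move=> i j /bK[{2}<- il] /bK[{2}<- jl].
  by rewrite fX.
have -> : [seq (index i s).+1 | i <- enum S]
    = map succn (map (index^~ s) (enum S)) by rewrite -map_comp.
have -> : iota 1 #|S| = map succn (map (index^~ s) s).
  rewrite -map_comp (_ : map _ s = map succn (iota 0 #|S|)).
    by rewrite -[1]/(1 + 0) iotaDl.
  apply: (@eq_from_nth _ 0); rewrite !size_map !size_iota // => i il.
  rewrite (nth_map (f 0)) ?size_map ?size_iota // [RHS](nth_map 0) ?size_iota //.
  by rewrite /= index_uniq ?nth_iota // size_map size_iota.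
do 2!apply: perm_map; apply: uniq_perm => //; first exact: enum_uniq.
by move=> i; rewrite mem_enum Sf.
Qed.

Section Extend.
Variables (T : dynkin_type) (m : nat) (f : nat -> 'I_n) (v : 'I_n) (a : nat).
Hypotheses (fT : numbered T m f) (v_new : v \notin map f (iota 1 m)).
Hypotheses (am : 0 < a <= m) (Xv : forall k, 0 < k <= m -> X v (f k) = (k == a)).

Definition extend (i : nat) := if i == 0 then v else f i.

Lemma extend_inj : {in [pred i | i <= m] &, injective extend}.
Proof.
have [_ finj _] := fT; have new k : 0 < k -> k <= m -> v <> f k.
  by move=> k0 km vk; move/mem_map_iota1: v_new; apply; exists k; rewrite ?k0.
move=> [|i] [|j] //= im jm; rewrite /extend /=.
- by move/new => /(_ isT jm).
- by move/esym/new => /(_ isT im).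
- exact: finj.
Qed.

Lemma extend_adj i j : i <= m -> j <= m ->
  X (extend i) (extend j) = attach T m a i j.
Proof.
have [_ _ fX] := fT.
case: i j => [|i] [|j] im jm; rewrite /extend /attach /=.
- by rewrite X_irr; case: a am.
- exact: Xv.
- by rewrite X_sym Xv.
- exact: fX.
Qed.

Lemma extend_numbered T' M rho :
  embeds T m a T' M rho -> numbered T' M (extend \o rho).
Proof.
case=> Mr rhom rho_inj rhoX; split=> //.
  move=> i j iM jM /= /extend_inj ij; apply: rho_inj => //.
  by apply: ij; apply: rhom.
by move=> i j iM jM /=; rewrite extend_adj ?rhoX ?rhom.
Qed.

(** The neighbour of mark at least 2 alone breaks the bound for the type E subdiagram and the vertex
    [x]. *)
Lemma not_overextended : mark_bound -> ~ overextended T m a.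
Proof.
move=> bound [M [rho [x [y [rho_emb xm xrho [yM xy] y2]]]]].
have [_ rhom _ _] := rho_emb.
have /bound := extend_numbered rho_emb; move=> /(_ (extend x)).
have x_new : extend x \notin map (extend \o rho) (iota 1 M).
  apply/mem_map_iota1 => -[k kM /= /extend_inj xk]; apply: (xrho k kM).
  by rewrite xk // inE ?rhom.
move=> /(_ x_new); apply/negP; rewrite -ltnNge.
rewrite (big_rem y) /=; last by rewrite mem_index_iota ltnS.
by rewrite extend_adj ?rhom // xy muln1 ltn_addr.
Qed.

(** By counting, the injection [rho] hits every label 0, ..., [m]. *)
Lemma extend_onto T' rho : embeds T m a T' m.+1 rho ->
  map (extend \o rho) (iota 1 m.+1) =i v :: map f (iota 1 m).
Proof.
case=> _ rhom rho_inj _ w.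
have -> : v :: map f (iota 1 m) = map extend (iota 0 m.+1).
  by rewrite /=; congr cons; apply/eq_in_map => k; rewrite mem_iota; case: k.
rewrite map_comp; apply: eq_mem_map => {w}.
have rho_uniq : uniq (map rho (iota 1 m.+1)).
  rewrite map_inj_in_uniq ?iota_uniq // => i j.
  by rewrite !mem_iota add1n => i_in j_in; apply: rho_inj.
have sub : {subset map rho (iota 1 m.+1) <= iota 0 m.+1}.
  move=> _ /mapP[k km ->]; rewrite mem_iota ltnS rhom //.
  by move: km; rewrite mem_iota add1n.
by have [] := uniq_min_size rho_uniq sub; rewrite // size_map !size_iota.
Qed.

End Extend.

(** Marks are positive, so the bound leaves [v] a single neighbour, of mark 1. *)
Lemma attach_vertex T m f v : mark_bound -> numbered T m f ->
  v \notin map f (iota 1 m) -> (exists2 k, 0 < k <= m & X v (f k)) ->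
  exists T' f', numbered T' m.+1 f' /\
    map f' (iota 1 m.+1) =i v :: map f (iota 1 m).
Proof.
move=> bound fT v_new [a am Xva]; have [mr _ _] := fT.
have := bound T m f v fT v_new.
rewrite (big_rem a) /=; last by rewrite mem_index_iota ltnS.
rewrite Xva muln1; have := mark_gt0 mr am => ma0 ma.
have ma1 : mark T m a = 1 by lia.
have Xv k : 0 < k <= m -> X v (f k) = (k == a).
  move=> km; have [->//|ka] := eqVneq k a.
  move: ma; rewrite (big_rem k) /=; last first.
    by rewrite mem_rem_uniq ?inE ?ka ?mem_index_iota ?ltnS ?iota_uniq.
  by have := mark_gt0 mr km; case: (X v (f k)) => //; lia.
have [[T' [rho emb]]|] := attach_mark1 mr am ma1.
  exists T', (extend f v \o rho); split.
    exact: (extend_numbered fT v_new am Xv emb).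
  exact: (extend_onto f v emb).
by move/(not_overextended fT v_new am Xv bound).
Qed.

(** Connectedness in terms of cuts, which directly supplies the next vertex to attach. *)
Definition connected_set (S : {set 'I_n}) : Prop :=
  S != finset.set0 /\ forall A : {set 'I_n}, A \proper S -> A != finset.set0 ->
    exists i j, [/\ i \in A, j \in (S :\: A)%SET & X j i].

Lemma connected_numbered (S : {set 'I_n}) : mark_bound -> connected_set S ->
  exists T b, bourbaki_numbering X S T b.
Proof.
move=> bound [S0 S_conn].
suff [T [f [fT Sf]]] : exists T f, numbered T #|S| f /\
    S =i map f (iota 1 #|S|).
  by exists T; apply: numbered_bourbaki fT Sf.
suff grow m : 0 < m <= #|S| -> exists T f (A : {set 'I_n}),
    [/\ numbered T m f, A \subset S, #|A| = m & A =i map f (iota 1 m)].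
  have [|T [f [A [fT AS Am Af]]]] := grow #|S|; first by rewrite card_gt0 S0 /=.
  have /eqP <- : A == S by rewrite eqEcard AS Am /=.
  by exists T, f; split=> //; rewrite Am.
elim: m => // m IHm mS; have [m0|m0] := posnP m; first rewrite {IHm mS}m0.
  have [x xS] := finset.set0Pn _ S0; exists TypeA, (fun=> x), [set x]%SET.
  split; [|by rewrite finset.sub1set|exact: cards1|by move=> y; rewrite !inE].
  split=> // i j; rewrite ?inE; first by case: i j => [|[|i]] [|[|j]].
  by case: i j => [|[|i]] [|[|j]] //; rewrite X_irr.
have [|T [f [A [fT AS Am Af]]]] := IHm; first by rewrite m0 ltnW.
have [||x [v [xA]]] := S_conn A; first by rewrite properEcard AS Am.
  by rewrite -card_gt0 Am.
rewrite inE => /andP[vA vS] Xvx.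
have [||T' [f' [f'T f'A]]] := attach_vertex bound fT (v := v).
- by rewrite -Af.
- by move: xA; rewrite Af => /mem_map_iota1[k km xk]; exists k; rewrite -?xk.
exists T', f', (v |: A)%SET; split=> //.
  - by rewrite finset.subUset finset.sub1set vS.
  - by rewrite cardsU1 vA Am.
  - by move=> w; rewrite f'A !inE Af.
Qed.

End Numbering.

(** * Root systems *)

Section Roots.
Variables (R : realType) (V : vectType R) (ip : {dot V for idfun}).
Variables (Phi : {fset V}) (n : nat) (alpha omega : 'I_n -> V) (a0 : V).
Hypothesis Phi_rs : root_system ip Phi.
Hypothesis Phi_sl : simply_laced ip Phi.
Hypothesis alpha_simple : simple_roots Phi alpha.
Hypothesis omega_fund : fundamental_weights ip alpha omega.
Hypothesis a0_root : a0 \in Phi.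

(* The inner product scaled so that all roots have squared norm 2; pairing with
   a root is then pairing with its coroot. *)
Definition nip (u v : V) : R := 2 / ip a0 a0 * ip u v.
Local Notation B := nip.
Local Notation X := (dynkin_diagram ip alpha).

Lemma a0_norm_gt0 : 0 < ip a0 a0.
Proof.
apply: neq0_dnorm_gt0; apply: contraTneq a0_root => ->.
exact: root_neq0 Phi_rs.
Qed.

Lemma nipC u v : B u v = B v u.
Proof. by rewrite /nip (hermC _ u v) expr0 mul1r. Qed.

Lemma nipDl u v w : B (u + v) w = B u w + B v w.
Proof. by rewrite /nip linearDl mulrDr. Qed.

Lemma nipDr u v w : B w (u + v) = B w u + B w v.
Proof. by rewrite !(nipC w) nipDl. Qed.

Lemma nipNl u w : B (- u) w = - B u w.
Proof. by rewrite /nip linearNl mulrN. Qed.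

Lemma nipNr u w : B w (- u) = - B w u.
Proof. by rewrite !(nipC w) nipNl. Qed.

Lemma nipZl c u w : B (c *: u) w = c * B u w.
Proof. by rewrite /nip linearZl_LR /= mulrCA. Qed.

Lemma nipZr c u w : B w (c *: u) = c * B w u.
Proof. by rewrite !(nipC w) nipZl. Qed.

Lemma nip0l w : B 0 w = 0.
Proof. by rewrite /nip linear0l mulr0. Qed.

Lemma nipMnl u w k : B (u *+ k) w = B u w *+ k.
Proof. by rewrite /nip linearMnl mulrnAr. Qed.

Lemma nip_suml I (r : seq I) P (F : I -> V) w :
  B (\sum_(i <- r | P i) F i) w = \sum_(i <- r | P i) B (F i) w.
Proof. by rewrite /nip linear_sumlz mulr_sumr. Qed.

Lemma nip_gt0 u : u != 0 -> 0 < B u u.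
Proof.
move=> u0; rewrite mulr_gt0 ?divr_gt0 ?a0_norm_gt0 //.
exact: neq0_dnorm_gt0.
Qed.

Lemma nip_eq0 u : B u u = 0 -> u = 0.
Proof. by move=> u0; apply/eqP/negPn/negP => /nip_gt0; rewrite u0 ltxx. Qed.

Lemma ip_coroot v a : a \in Phi -> ip v (coroot ip a) = B v a.
Proof.
by move=> aP; rewrite /coroot linearZr_LR /= (Phi_sl aP a0_root).
Qed.

Lemma nip_root a : a \in Phi -> B a a = 2.
Proof.
move=> aP; rewrite /nip (Phi_sl aP a0_root) divfK //.
by rewrite gt_eqF // a0_norm_gt0.
Qed.

Lemma reflectionE a v : a \in Phi -> reflection ip a v = v - B v a *: a.
Proof. by move=> aP; rewrite /reflection ip_coroot. Qed.

Lemma reflection_nip a u v : a \in Phi ->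
  B (reflection ip a u) (reflection ip a v) = B u v.
Proof.
move=> aP; rewrite !reflectionE // !(nipDl, nipDr, nipNl, nipNr, nipZl, nipZr).
by rewrite nip_root // (nipC a v); lra.
Qed.

Lemma reflectionK a : a \in Phi -> involutive (reflection ip a).
Proof.
move=> aP v; rewrite !reflectionE // !(nipDl, nipNl, nipZl) nip_root //.
have -> : B v a - B v a * 2 = - B v a by lra.
by rewrite scaleNr opprK subrK.
Qed.

Lemma rootN a : a \in Phi -> - a \in Phi.
Proof.
move=> aP; have := root_reflection Phi_rs aP aP.
rewrite reflectionE // nip_root // (_ : a - _ = - a) //.
by rewrite scaler_nat mulr2n opprD addNKr.
Qed.

Lemma nip_root_int a b : a \in Phi -> b \in Phi -> B a b \is a Num.int.
Proof.
by move=> aP bP; rewrite -ip_coroot //; exact: (root_crystallographic Phi_rs bP aP).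
Qed.

Lemma int_lt_le (x : R) (m : int) : x \is a Num.int -> x < (m + 1)%:~R -> x <= m%:~R.
Proof. by case/intrP => k ->; rewrite ltr_int ler_int ltzD1. Qed.

Lemma int_gt0_ge1 (x : R) : x \is a Num.int -> 0 < x -> 1 <= x.
Proof. by case/intrP => k ->; rewrite ltr0z ler1z gtz0_ge1. Qed.

(** The norm of [a - b] is 4 minus twice the pairing and is positive, so this integer is below 2. *)
Lemma nip_root_le1 a b : a \in Phi -> b \in Phi -> a != b -> B a b <= 1.
Proof.
move=> aP bP ab; apply: (@int_lt_le _ 1); first exact: nip_root_int.
have := nip_gt0 (u := a - b); rewrite subr_eq0 => /(_ ab).
by rewrite !(nipDl, nipDr, nipNl, nipNr) !nip_root // (nipC b a); lra.
Qed.

Lemma nip_root_geN1 a b : a \in Phi -> b \in Phi -> a != - b -> -1 <= B a b.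
Proof.
by move=> aP bP ab; have := nip_root_le1 aP (rootN bP) ab; rewrite nipNr; lra.
Qed.

Lemma alpha_in i : alpha i \in Phi. Proof. exact: simple_in alpha_simple i. Qed.

Lemma nip_omega i j : B (omega i) (alpha j) = (i == j)%:R.
Proof. by rewrite -ip_coroot ?alpha_in // omega_fund. Qed.

(** For the scaled product the fundamental weights are the basis dual to the simple roots. *)
Lemma alpha_expand v : v = \sum_i B (omega i) v *: alpha i.
Proof.
suff [c vc] : exists c : 'I_n -> R, v = \sum_i c i *: alpha i.
  rewrite [LHS]vc; apply: eq_bigr => i _; congr (_ *: _).
  rewrite vc nipC nip_suml (bigD1 i) //= nipZl nipC nip_omega eqxx mulr1.
  by rewrite big1 ?addr0 // => j ji; rewrite nipZl nipC nip_omega eq_sym (negPf ji) mulr0.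
have : v \in <<codom alpha>>%VS.
  by have /andP[/eqP -> _] := simple_basis alpha_simple; rewrite memvf.
rewrite span_def codomE big_map big_enum => /memv_sumP[u uv ->].
exists (fun i => B (omega i) (u i)); apply: eq_bigr => i _.
have /vlineP[k ->] := uv i isT.
by rewrite nipZr nip_omega eqxx mulr1.
Qed.

Lemma nip_alpha_inj u v : (forall i, B u (alpha i) = B v (alpha i)) -> u = v.
Proof.
move=> uv; apply/eqP; rewrite -subr_eq0; apply/eqP/nip_eq0.
rewrite {2}(alpha_expand (u - v)) nipC nip_suml big1 // => i _.
by rewrite nipZl (nipC (alpha i)) nipDl nipNl uv subrr mulr0.
Qed.

(** * Nonnegative combinations of simple roots and the Cartan matrix *)

Definition comb (c : 'I_n -> nat) : V := \sum_i alpha i *+ c i.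

Lemma nip_comb c w : B (comb c) w = \sum_i (c i)%:R * B (alpha i) w.
Proof.
by rewrite nip_suml; apply: eq_bigr => i _; rewrite nipMnl mulr_natl.
Qed.

Lemma nip_omega_comb i c : B (omega i) (comb c) = (c i)%:R.
Proof.
rewrite nipC nip_comb (bigD1 i) //= nipC nip_omega eqxx mulr1 big1 ?addr0 //.
by move=> j ji; rewrite nipC nip_omega eq_sym (negPf ji) mulr0.
Qed.

Lemma alpha_neq i j : i != j -> alpha i != alpha j.
Proof.
move=> ij; apply/eqP => /(congr1 (B (omega i))).
by rewrite !nip_omega eqxx (negPf ij) => /eqP; rewrite oner_eq0.
Qed.

Lemma alpha_neqN i j : alpha i != - alpha j.
Proof.
apply/eqP => /(congr1 (B (omega i))); rewrite nipNr !nip_omega eqxx.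
by case: (i == j) => /=; lra.
Qed.

(** If the pairing were 1, the reflected root [alpha i - alpha j] would have coefficients of both
    signs. *)
Lemma nip_alpha_le0 i j : i != j -> B (alpha i) (alpha j) <= 0.
Proof.
move=> ij; apply: (@int_lt_le _ 0); first by apply: nip_root_int; apply: alpha_in.
rewrite lt_neqAle nip_root_le1 ?alpha_in ?alpha_neq // andbT; apply/eqP => ij1.
have := root_reflection Phi_rs (alpha_in j) (alpha_in i).
rewrite reflectionE ?alpha_in // ij1 scale1r => /(simple_sign alpha_simple).
case=> [[c]|[c]].
  move/(congr1 (B (omega j))); rewrite nip_omega_comb nipDr nipNr !nip_omega eqxx.
  by rewrite eq_sym (negPf ij) /=; have := ler0n R (c j); lra.
move/(congr1 (B (omega i))); rewrite nip_omega_comb nipNr nipDr nipNr !nip_omega.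
by rewrite eqxx (negPf ij) /=; have := ler0n R (c i); lra.
Qed.

Lemma nip_alpha i j : B (alpha i) (alpha j) = 2 * (i == j)%:R - (X i j)%:R.
Proof.
rewrite /dynkin_diagram ip_coroot ?alpha_in //.
have [->|ij] /= := eqVneq i j; first by rewrite nip_root ?alpha_in // mulr1 subr0.
have := nip_alpha_le0 ij; rewrite le_eqVlt => /predU1P[->|ij0].
  by rewrite eq_sym oppr_eq0 oner_eq0 subr0 mulr0.
suff -> : B (alpha i) (alpha j) = -1 by rewrite eqxx mulr0 sub0r.
apply/eqP; rewrite eq_le nip_root_geN1 ?alpha_in ?alpha_neqN // andbT.
by apply: (@int_lt_le _ (-1)); first by apply: nip_root_int; apply: alpha_in.
Qed.

Lemma dynkin_sym : symmetric X.
Proof.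
move=> i j; have := nip_alpha i j; rewrite nipC nip_alpha eq_sym.
by case: (X i j); case: (X j i) => //=; lra.
Qed.

Lemma dynkin_irr : irreflexive X.
Proof. by move=> i; rewrite /dynkin_diagram eqxx. Qed.

Lemma nip_comb_alpha c j :
  B (comb c) (alpha j) = (2 * c j)%:R - (\sum_i c i * X i j)%:R.
Proof.
rewrite nip_comb natr_sum (eq_bigr (fun i => 2 * (c i)%:R * (i == j)%:R
  - (c i * X i j)%:R)); last by move=> i _; rewrite nip_alpha natrM; lra.
rewrite sumrB; congr (_ - _); rewrite (bigD1 j) //= eqxx mulr1 natrM.
by rewrite big1 ?addr0 // => i /negPf ->; rewrite mulr0.
Qed.


Lemma comb_add c i : comb (fun j => c j + (j == i))%N = comb c + alpha i.
Proof.
rewrite /comb; under eq_bigr do rewrite mulrnDr.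
rewrite big_split; congr (_ + _); rewrite (bigD1 i) //= eqxx mulr1n.
by rewrite big1 ?addr0 // => j /negPf ->.
Qed.

Lemma comb_sub c i : (0 < c i)%N ->
  comb (fun j => c j - (j == i))%N = comb c - alpha i.
Proof.
move=> ci; apply/esym/eqP; rewrite subr_eq -comb_add; apply/eqP.
apply: eq_bigr => j _; congr (_ *+ _); rewrite subnK //.
by case: eqP => // ->.
Qed.

Lemma sum_decr (c : 'I_n -> nat) i : (0 < c i)%N ->
  (\sum_j (c j - (j == i)) < \sum_j c j)%N.
Proof.
move=> ci; rewrite (bigD1 i) //= [X in (_ < X)%N](bigD1 i) //= eqxx -addSn.
by rewrite leq_add ?subn1 ?prednK //; apply: leq_sum => j _; apply: leq_subr.
Qed.

Lemma nip_comb_int c j : B (comb c) (alpha j) \is a Num.int.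
Proof. by rewrite nip_comb_alpha rpredB ?natr_int. Qed.

Lemma comb_pos_exists c (v : V) : 0 < B (comb c) v ->
  exists2 i, (0 < c i)%N & 0 < B (alpha i) v.
Proof.
move=> c_gt0; apply: contrapT => none; move: c_gt0; apply/negP.
rewrite -leNgt nip_comb; apply: sumr_le0 => i _.
have [->|ci] := posnP (c i); first by rewrite mul0r.
rewrite mulr_ge0_le0 ?ler0n // leNgt; apply/negP => vi.
by apply: none; exists i.
Qed.

(** Induction on height: some simple root in the support pairs positively, hence to 1 unless it is
    the whole vector. Subtracting it keeps norm 2, and its reflection leads back. *)
Lemma norm2_root c : B (comb c) (comb c) = 2 -> comb c \in Phi.
Proof.
have [N] := ubnP (\sum_i c i)%N; elim: N c => // N IHN c cN c2.
have [|i ci vi] := @comb_pos_exists c (comb c); first by rewrite c2.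
have [->|vNi] := eqVneq (comb c) (alpha i); first exact: alpha_in.
have vi1 : B (comb c) (alpha i) = 1.
  have v_int := nip_comb_int c i; rewrite nipC in vi.
  apply/eqP; rewrite eq_le (@int_lt_le _ 1) //=.
    exact: int_gt0_ge1.
  have := nip_gt0 (u := comb c - alpha i); rewrite subr_eq0 => /(_ vNi).
  rewrite !(nipDl, nipDr, nipNl, nipNr) c2 (nip_root (alpha_in i)).
  by rewrite (nipC (alpha i)) -[(1 + 1)%:~R]/(2 : R); lra.
have c'P : comb (fun j => c j - (j == i))%N \in Phi.
  apply: IHN; first by rewrite -ltnS (leq_trans _ cN) // ltnS sum_decr.
  rewrite comb_sub // !(nipDl, nipDr, nipNl, nipNr) c2 (nip_root (alpha_in i)).
  by rewrite (nipC (alpha i)) vi1; lra.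
have := root_reflection Phi_rs (alpha_in i) c'P.
rewrite comb_sub // reflectionE ?alpha_in // nipDl nipNl vi1 nip_root ?alpha_in //.
by rewrite (_ : 1 - 2 = -1) ?scaleN1r ?opprK ?subrK //; lra.
Qed.

(* J is either the type of vertices, with F the identity, or the type of labels,
   with b the identity. *)
Section MarkVector.
Variables (J : eqType) (r : seq J) (F : J -> 'I_n) (b : J -> nat).
Variables (T : dynkin_type) (m : nat).
Hypotheses (mr : dynkin_rank T m) (br : perm_eq (map b r) (iota 1 m)).
Hypotheses (F_inj : {in r &, injective F})
  (FX : {in r &, forall i j, X (F i) (F j) = bourbaki_adj T m (b i) (b j)}).

Definition mark_vector : V := \sum_(i <- r) alpha (F i) *+ mark T m (b i).

Lemma sum_numbered (G : nat -> nat) :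
  (\sum_(i <- r) G (b i) = \sum_(1 <= k < m.+1) G k)%N.
Proof. by rewrite -(big_map b predT G) (perm_big _ br) /index_iota subn1. Qed.

Lemma mark_vector_alpha j : j \in r ->
  B mark_vector (alpha (F j)) = (affine_edges T m (b j))%:R.
Proof.
move=> jr; have r_uniq : uniq r.
  by apply: (map_uniq (f := b)); rewrite (perm_uniq br) iota_uniq.
have bj : (0 < b j <= m)%N.
  by have := map_f b jr; rewrite (perm_mem br) mem_iota add1n ltnS.
rewrite nip_suml (eq_big_seq (fun i => (2 * (mark T m (b i))%:R) * (i == j)%:R
    - (mark T m (b i) * bourbaki_adj T m (b i) (b j))%:R)); last first.
  move=> i ir; rewrite nipMnl nip_alpha FX // (inj_in_eq F_inj) //.
  by rewrite -mulr_natl natrM; lra.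
rewrite sumrB -natr_sum (sum_numbered (fun k => mark T m k * bourbaki_adj T m k (b j))%N).
rewrite (bigD1_seq j) //= eqxx mulr1 big1 ?addr0; last first.
  by move=> i /negPf ->; rewrite mulr0.
have := sum_mark_adj mr bj => /(congr1 (fun k => k%:R : R)).
by rewrite natrD natrM; lra.
Qed.

Lemma mark_vector_norm : B mark_vector mark_vector = 2.
Proof.
rewrite {2}/mark_vector nipC nip_suml.
rewrite (eq_big_seq (fun i => (mark T m (b i) * affine_edges T m (b i))%:R)).
  by rewrite -natr_sum (sum_numbered (fun k => mark T m k * affine_edges T m k)%N)
    sum_mark_affine.
by move=> i ir; rewrite nipMnl nipC mark_vector_alpha // natrM mulr_natl.
Qed.

Lemma mark_vector_out v : v \notin map F r ->
  B mark_vector (alpha v) = - (\sum_(i <- r) mark T m (b i) * X (F i) v)%:R.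
Proof.
move=> vF; rewrite nip_suml natr_sum -sumrN; apply: eq_big_seq => i ir.
rewrite nipMnl nip_alpha (_ : (F i == v) = false); last first.
  by apply: contraNF vF => /eqP <-; apply: map_f.
by rewrite mulr0 sub0r mulNrn mulnC mulrnA.
Qed.

Lemma mark_vector_bound v : v \notin map F r ->
  (\sum_(i <- r) mark T m (b i) * X v (F i) <= 1)%N.
Proof.
(* Only [alpha v] contributes at [v], so the coefficient there is 1. *)
move=> vF; have /nip_gt0 : mark_vector + alpha v != 0.
  apply/eqP => /(congr1 (B (omega v))); rewrite nipDr nip_omega eqxx.
  rewrite (nipC _ 0) nip0l nipC nip_suml big1_seq ?add0r => [/eqP|i /= ir].
    by rewrite oner_eq0.
  rewrite nipMnl nipC nip_omega (_ : (v == F i) = false) ?mul0rn //.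
  by apply: contraNF vF => /eqP ->; apply: map_f.
rewrite !(nipDl, nipDr) mark_vector_norm nip_root ?alpha_in // (nipC (alpha v)).
rewrite mark_vector_out //; under eq_bigr do rewrite dynkin_sym.
set s := (\sum_(i <- r) _)%N => h; have : s%:R < 2%:R :> R by lra.
by rewrite ltr_nat.
Qed.

End MarkVector.

Lemma dynkin_mark_bound : mark_bound X.
Proof.
move=> T m f v [mr f_inj fX] vf.
have i_in i : i \in iota 1 m -> (0 < i <= m)%N by rewrite mem_iota add1n ltnS.
rewrite /index_iota subn1; apply: (@mark_vector_bound _ (iota 1 m) f id T m) => //.
- by rewrite map_id.
- by move=> i j /i_in im /i_in jm; apply: f_inj.
- by move=> i j /i_in im /i_in jm; apply: fX.
Qed.


(** * The Weyl group through words in simple reflections *)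

Lemma root_sign a : a \in Phi ->
  (exists c, a = comb c) \/ (exists c, - a = comb c).
Proof. exact: simple_sign alpha_simple a. Qed.

Definition word_act (t : seq 'I_n) (v : V) : V :=
  foldr (fun i => reflection ip (alpha i)) v t.

Lemma word_act_cat s t v : word_act (s ++ t) v = word_act s (word_act t v).
Proof. by rewrite /word_act foldr_cat. Qed.

Lemma word_actK t v : word_act (rev t) (word_act t v) = v.
Proof.
elim: t => //= i t IHt; rewrite rev_cons -cats1 word_act_cat /=.
by rewrite reflectionK ?alpha_in.
Qed.

Lemma word_act_nip t u v : B (word_act t u) (word_act t v) = B u v.
Proof. by elim: t => //= i t IHt; rewrite reflection_nip ?alpha_in. Qed.

Lemma reflectionD a u v :
  reflection ip a (u + v) = reflection ip a u + reflection ip a v.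
Proof. by rewrite /reflection linearDl scalerDl opprD addrACA. Qed.

Lemma reflectionN a v : reflection ip (- a) v = reflection ip a v.
Proof.
rewrite /reflection /coroot linearNl linearNr opprK.
by rewrite !scalerN linearNr scaleNr opprK.
Qed.

Lemma word_actD t u v : word_act t (u + v) = word_act t u + word_act t v.
Proof. by elim: t => //= i t ->; rewrite reflectionD. Qed.

Lemma word_act_root t a : a \in Phi -> word_act t a \in Phi.
Proof.
move=> aP; elim: t => //= i t IHt.
exact: (root_reflection Phi_rs (alpha_in i) IHt).
Qed.

Lemma reflectionZ a c v : reflection ip a (c *: v) = c *: reflection ip a v.
Proof. by rewrite /reflection linearZl_LR /= scalerBr scalerA. Qed.

Lemma reflection_conj a b v : a \in Phi -> b \in Phi ->
  reflection ip a (reflection ip b v)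
  = reflection ip (reflection ip a b) (reflection ip a v).
Proof.
move=> aP bP; have abP := root_reflection Phi_rs aP bP.
rewrite [RHS]reflectionE // reflection_nip // (reflectionE v bP).
by rewrite reflectionD -scaleNr reflectionZ scaleNr.
Qed.

Lemma word_act_reflection t b v : b \in Phi ->
  word_act t (reflection ip b v) = reflection ip (word_act t b) (word_act t v).
Proof.
move=> bP; elim: t => //= i t ->.
by rewrite reflection_conj ?alpha_in ?word_act_root.
Qed.

(** Induction on height: a simple reflection lowers a positive nonsimple root, and the reflection in
    the root is the conjugate of the one in the lowered root. *)
Lemma reflection_word a : a \in Phi ->
  exists t, forall v, reflection ip a v = word_act t v.
Proof.
suff pos c : comb c \in Phi ->
    exists t, forall v, reflection ip (comb c) v = word_act t v.
  move=> aP; case: (root_sign aP) => -[c ac].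
    by rewrite ac; apply: pos; rewrite -ac.
  have [|t tP] := pos c; first by rewrite -ac rootN.
  by exists t => v; rewrite -tP -ac reflectionN.
have [N] := ubnP (\sum_i c i)%N; elim: N c => // N IHN c cN cP.
have [|i ci vi] := @comb_pos_exists c (comb c); first by rewrite nip_root.
have [->|vNi] := eqVneq (comb c) (alpha i); first by exists [:: i].
have vi1 : B (comb c) (alpha i) = 1.
  rewrite nipC in vi; apply/eqP; rewrite eq_le nip_root_le1 ?alpha_in //=.
  exact: int_gt0_ge1 (nip_comb_int c i) vi.
have c'E : reflection ip (alpha i) (comb c) = comb (fun j => c j - (j == i))%N.
  by rewrite reflectionE ?alpha_in // vi1 scale1r comb_sub.
have c'P : comb (fun j => c j - (j == i))%N \in Phi.
  by rewrite -c'E (root_reflection Phi_rs (alpha_in i) cP).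
have [|t tP] := IHN _ _ c'P.
  by rewrite -ltnS (leq_trans _ cN) // ltnS sum_decr.
exists (i :: rcons t i) => v.
rewrite -cats1 /= word_act_cat -tP -c'E /= reflection_conj ?alpha_in //.
  by rewrite !reflectionK ?alpha_in.
by rewrite c'E.
Qed.

Lemma weyl_orbit_word u v : weyl_orbit ip Phi v u -> exists t, u = word_act t v.
Proof.
case=> w [s sP ->] -> {w u}.
elim: s sP => [|a s IHs] sP; first by exists [::].
have [|t tE] := IHs; first by move=> b bs; apply: sP; rewrite inE bs orbT.
have [|t' t'E] := @reflection_word a; first by apply: sP; rewrite inE eqxx.
by exists (t' ++ t); rewrite word_act_cat -t'E -tE.
Qed.

Lemma weyl_orbit_refl v : weyl_orbit ip Phi v v.
Proof. by exists id => //; exists [::]. Qed.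

(** A reflection in [alpha j] changes only the coefficient at [j], so all others must vanish; norm 2
    then forces coefficient 1. *)
Lemma negative_simple c d j : comb c \in Phi ->
  reflection ip (alpha j) (comb c) = - comb d -> comb c = alpha j.
Proof.
move=> cP cd; have c0 i : i != j -> c i = 0%N.
  move=> ij; move/(congr1 (B (omega i))): cd.
  rewrite reflectionE ?alpha_in // nipNr nipDr nipNr nipZr nip_omega (negPf ij).
  rewrite mulr0 subr0 !nip_omega_comb => cd0; apply/eqP.
  rewrite -(pnatr_eq0 R); apply/eqP.
  by have := ler0n R (c i); have := ler0n R (d i); lra.
have cE : comb c = (c j)%:R *: alpha j.
  by rewrite /comb (bigD1 j) //= big1 ?addr0 ?scaler_nat // => i /c0 ->.
have := nip_root cP; rewrite cE nipZl nipZr nip_root ?alpha_in // => cj2.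
suff -> : c j = 1%N by rewrite scale1r.
have : ((c j) * (c j))%:R = 1%:R :> R by rewrite natrM; lra.
by move/eqP; rewrite eqr_nat muln_eq1 => /andP[/eqP].
Qed.

(** The exchange condition: some letter [j] turns the image of [alpha i] from positive to negative.
    That image is [alpha j], so moving the reflection in [alpha i] past the later letters makes it
    cancel [j]. *)
Lemma word_exchange t i d : word_act t (alpha i) = - comb d ->
  exists2 t', size t = (size t').+1
    & forall v, word_act t (reflection ip (alpha i) v) = word_act t' v.
Proof.
elim: t d => [|j t IHt] d /=.
  move/(congr1 (B (omega i))); rewrite nipNr nip_omega eqxx nip_omega_comb /= => di.
  by exfalso; have := ler0n R (d i); lra.
have tP := word_act_root t (alpha_in i).
case: (root_sign tP) => -[c tc].
  rewrite tc => /negative_simple ti; exists t => // v.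
  rewrite word_act_reflection ?alpha_in // tc ti; last by rewrite -tc.
  by rewrite reflectionK ?alpha_in.
move=> _; have [|t' tt' t'E] := IHt c; first by rewrite -tc opprK.
by exists (j :: t') => [|v]; rewrite /= ?tt' ?t'E.
Qed.

Definition dominant (v : V) : Prop := forall i, 0 <= B v (alpha i).

Lemma dominant_comb v c : dominant v -> 0 <= B v (comb c).
Proof.
move=> v_dom; rewrite nipC nip_comb; apply: sumr_ge0 => i _.
by rewrite mulr_ge0 ?ler0n // nipC v_dom.
Qed.

Lemma dominant_unique t u v : dominant u -> dominant v -> u = word_act t v -> u = v.
Proof.
move=> u_dom v_dom; have [N] := ubnP (size t); elim: N t => // N IHN.
case/lastP => [|t i] //=; rewrite size_rcons -cats1 word_act_cat /= ltnS => tN uE.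
case: (root_sign (word_act_root t (alpha_in i))) => -[c tc].
  suff vi : B v (alpha i) = 0.
    by apply: (IHN t) => //; rewrite uE reflectionE ?alpha_in // vi scale0r subr0.
  have := dominant_comb c u_dom; rewrite -tc uE word_act_nip.
  rewrite reflectionE ?alpha_in // nipDl nipNl nipZl nip_root ?alpha_in //.
  by have := v_dom i; lra.
have [|t' tt' t'E] := @word_exchange t i c; first by rewrite -tc opprK.
by apply: (IHN t'); [rewrite -ltnS -tt' ltnW|rewrite uE t'E].
Qed.


(** * Firing moves *)

Definition lam (g : {ffun 'I_n -> nat}) : V := \sum_i omega i *+ g i.

Lemma nip_lam g j : B (lam g) (alpha j) = (g j)%:R.
Proof.
rewrite nip_suml (bigD1 j) //= nipMnl nip_omega eqxx big1 ?addr0 // => i ij.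
by rewrite nipMnl nip_omega (negPf ij) mul0rn.
Qed.

Lemma lam_dominant g : dominant (lam g).
Proof. by move=> i; rewrite nip_lam ler0n. Qed.

Lemma lam_inj : injective lam.
Proof.
move=> g h gh; apply/ffunP => i; apply/eqP; rewrite -(eqr_nat R).
by rewrite -!nip_lam gh.
Qed.

Lemma lam_surj v : dominant v -> (forall i, B v (alpha i) \is a Num.int) ->
  exists g, v = lam g.
Proof.
move=> v_dom v_int; exists [ffun i => Num.truncn (B v (alpha i))].
apply: nip_alpha_inj => i; rewrite nip_lam ffunE truncnK //.
by rewrite natrEint v_int v_dom.
Qed.

Lemma lam_weight g : weight ip Phi (lam g).
Proof.
have lam_comb c : B (lam g) (comb c) \is a Num.int.
  rewrite nipC nip_comb; apply: rpred_sum => i _.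
  by rewrite nipC nip_lam -natrM natr_int.
move=> a aP; rewrite ip_coroot //.
case: (root_sign aP) => -[c ac]; first by rewrite ac.
by rewrite -[a]opprK ac nipNr rpredN.
Qed.

(** * Highest roots of connected subdiagrams *)

Lemma nip_comb_even c : exists k : int, B (comb c) (comb c) = (2 * k)%:~R.
Proof.
have [N] := ubnP (\sum_i c i)%N; elim: N c => // N IHN c cN.
have [/eqfunP c0|/forallPn[i ci]] := boolP [forall i, c i == 0%N].
  exists 0; rewrite nip_comb big1 // => i _.
  by rewrite c0 mul0r.
rewrite -lt0n in ci; have [|k kE] := IHN (fun j => c j - (j == i))%N.
  by rewrite -ltnS (leq_trans _ cN) // ltnS sum_decr.
have /intrP[l lE] := nip_comb_int c i.
(* Removing [alpha i] changes the norm by [2 - 2 * l]. *)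
exists (k + l - 1); move: kE.
rewrite comb_sub // !(nipDl, nipDr, nipNl, nipNr).
rewrite (nip_root (alpha_in i)) (nipC (alpha i)) lE !intrM rmorphB rmorphD /=.
by rewrite rmorphD /= rmorph1; lra.
Qed.

Lemma nip_comb_ge2 c : comb c != 0 -> 2 <= B (comb c) (comb c).
Proof.
move/nip_gt0; have [k ->] := nip_comb_even c.
by rewrite ltr0z (_ : 2 = 2%:~R :> R) // ler_int; lia.
Qed.

(* For connected S, c is the coefficient vector of the highest root of the root
   subsystem spanned by the simple roots indexed by S. *)
Definition highest (S : {set 'I_n}) (c : 'I_n -> nat) : Prop :=
  [/\ comb c \in Phi, forall i, (i \in S) = (0 < c i)%N
    & forall i, i \in S -> 0 <= B (comb c) (alpha i)].

(** The difference pairs to [1 - 2] with [comb c'], yet its support would lie in [S], where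
    [comb c'] is dominant. *)
Lemma highest_sub_absurd S c c' d : highest S c -> highest S c' ->
  B (comb c) (comb c') = 1 -> comb c - comb c' <> comb d.
Proof.
move=> [cP cS c_dom] [c'P c'S c'_dom] cc' dE.
have : B (comb d) (comb c') = -1 by rewrite -dE nipDl nipNl cc' nip_root //; lra.
apply/eqP; rewrite gt_eqF // (lt_le_trans (ltrN10 R)) // nip_comb.
apply: sumr_ge0 => i _; have [->|di] := posnP (d i); first by rewrite mul0r.
rewrite mulr_ge0 ?ler0n // nipC c'_dom // cS.
move/(congr1 (B (omega i))): dE; rewrite nipDr nipNr !nip_omega_comb.
rewrite -(ltr_nat R) in di; rewrite -(ltr_nat R).
by have := ler0n R (c' i); lra.
Qed.

(** Full support and dominance on [S] make the pairing positive. For distinct roots it is then 1, so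
    their difference is a root, and neither sign is possible. *)
Lemma highest_unique S c c' : highest S c -> highest S c' -> comb c = comb c'.
Proof.
move=> cH c'H; have [cP cS c_dom] := cH; have [c'P c'S c'_dom] := c'H.
apply/eqP/negPn/negP => cNc'.
have cc'_gt0 : 0 < B (comb c) (comb c').
  have [|i c'i ic'] := @comb_pos_exists c' (comb c'); first by rewrite nip_root.
  rewrite nip_comb (bigD1 i) //= ltr_pwDl //.
    by rewrite mulr_gt0 // ltr0n -cS c'S.
  apply: sumr_ge0 => j _; have [->|cj] := posnP (c j); first by rewrite mul0r.
  by rewrite mulr_ge0 ?ler0n // nipC c'_dom // cS.
have cc' : B (comb c) (comb c') = 1.
  apply/eqP; rewrite eq_le nip_root_le1 //=.
  exact: int_gt0_ge1 (nip_root_int cP c'P) cc'_gt0.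
have := root_reflection Phi_rs c'P cP; rewrite reflectionE // cc' scale1r.
move=> /root_sign[] [d]; first exact: highest_sub_absurd cH c'H cc'.
by rewrite opprB; apply: highest_sub_absurd c'H cH _; rewrite nipC.
Qed.

Lemma highest_numbering S T b : bourbaki_numbering X S T b ->
  exists2 c, highest S c
    & forall i, i \in S -> B (comb c) (alpha i) = (affine_edges T #|S| (b i))%:R.
Proof.
case=> mr br bX; pose c i := if i \in S then mark T #|S| (b i) else 0%N.
have cE : comb c = mark_vector (enum S) id b T #|S|.
  rewrite /mark_vector big_enum /= [RHS]big_mkcond; apply: eq_bigr => i _.
  by rewrite /c; case: ifP.
have bX' : {in enum S &, forall i j, X i j = bourbaki_adj T #|S| (b i) (b j)}.
  by move=> i j; rewrite !mem_enum; apply: bX.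
have cA i : i \in S -> B (comb c) (alpha i) = (affine_edges T #|S| (b i))%:R.
  by move=> iS; rewrite cE (mark_vector_alpha mr br) ?mem_enum //; apply: in2W.
exists c => //; split=> [|i|i iS].
- by apply: norm2_root; rewrite cE (mark_vector_norm mr br) //; apply: in2W.
- rewrite /c; case: ifP => // iS; apply/esym/mark_gt0 => //.
  have := map_f b (_ : i \in enum S); rewrite mem_enum (perm_mem br) => /(_ iS).
  by rewrite mem_iota add1n.
- by rewrite cA.
Qed.

(** This is the decrease in a UCF move. The pairing is minus a sum of coefficients over the
    neighbours of [j] in [S], and it is at least -1. *)
Lemma highest_out S c j : highest S c -> j \notin S ->
  B (comb c) (alpha j) = - [exists i in S, X i j]%:R.
Proof.
move=> [cP cS _] jS; have cj : c j = 0%N by move: jS; rewrite cS; case: (c j).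
have := nip_root_geN1 cP (alpha_in j); rewrite nip_comb_alpha cj muln0 sub0r.
case: existsP => [[i /andP[iS ij]]|none] ge; last first.
  rewrite big1 // => i _; case: (boolP (X i j)) => [ij|_]; last by rewrite muln0.
  case: (posnP (c i)) => [->//|ci]; case: none; exists i.
  by rewrite cS ci.
congr (- _); apply/eqP; rewrite eqr_nat eqn_leq; apply/andP; split.
  rewrite -(ler_nat R) -lerN2; apply: ge; apply/eqP => /(congr1 (B (omega j))).
  by rewrite nipNr nip_omega nip_omega_comb cj eqxx /=; lra.
by rewrite (bigD1 i) //= ij muln1 ltn_addr // -cS.
Qed.

(** Across a cut without edges the root would split into two orthogonal nonzero parts, each of norm
    at least 2. *)
Lemma highest_connected S c : highest S c -> connected_set X S.
Proof.
move=> [cP cS _]; split.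
  apply/eqP => S0; have : 0 \in Phi.
    rewrite (_ : 0 = comb c) // /comb big1 // => i _.
    by have := cS i; rewrite S0 inE lt0n; case: (c i).
  by rewrite (negPf (root_neq0 Phi_rs)).
move=> A /properP[AS [k kS kA]] A0; apply: contrapT => none.
pose cA i := if i \in A then c i else 0%N.
pose cB i := if i \in A then 0%N else c i.
have cAB : comb c = comb cA + comb cB.
  rewrite /comb -big_split /=; apply: eq_bigr => i _.
  by rewrite -mulrnDr /cA /cB; case: ifP; rewrite ?addn0.
have AB0 : B (comb cA) (comb cB) = 0.
  rewrite nip_comb big1 // => i _; rewrite nipC nip_comb mulr_sumr big1 // => j _.
  rewrite /cA /cB; case: ifP => [iA|_]; last by rewrite mul0r.
  case: ifP => [_|jA]; first by rewrite mul0r mulr0.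
  have [->|cj] := posnP (c j); first by rewrite mul0r mulr0.
  rewrite nip_alpha; case: eqP => [ji|_]; first by rewrite ji iA in jA.
  case: (boolP (X j i)) => [Xji|_]; last by rewrite mulr0 subr0 !mulr0.
  by case: none; exists i, j; rewrite inE jA cS.
have nz d i : (0 < d i)%N -> comb d != 0.
  move=> di; apply/eqP => /(congr1 (B (omega i))).
  rewrite nip_omega_comb (nipC _ 0) nip0l => /eqP; rewrite pnatr_eq0.
  by rewrite gtn_eqF.
have A2 : 2 <= B (comb cA) (comb cA).
  have [i iA] := finset.set0Pn _ A0; apply/nip_comb_ge2/(nz cA i).
  by rewrite /cA iA -cS (fintype.subsetP AS).
have B2 : 2 <= B (comb cB) (comb cB).
  by apply/nip_comb_ge2/(nz cB k); rewrite /cB (negPf kA) -cS.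
have := nip_root cP; rewrite cAB !(nipDl, nipDr) AB0 (nipC (comb cB)) AB0.
by lra.
Qed.

(** Uniqueness of the highest root makes the affine edges independent of the numbering; the
    classification provides a numbering. *)
Lemma highest_completion S c e : highest S c ->
  affine_completion X S e <->
  forall i, (e i)%:R = if i \in S then B (comb c) (alpha i) else 0.
Proof.
move=> cH; split=> [[T [b [Tb eE]]] i|eE].
  have [c' c'H c'A] := highest_numbering Tb.
  by rewrite eE (highest_unique cH c'H); case: ifP => // iS; rewrite c'A.
have [T [b Tb]] := connected_numbered dynkin_sym dynkin_irr dynkin_mark_bound
  (highest_connected cH).
have [c' c'H c'A] := highest_numbering Tb.
exists T, b; split=> // i; apply/eqP; rewrite -(eqr_nat R) eE.
by rewrite (highest_unique cH c'H); case: ifP => // iS; rewrite c'A.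
Qed.

(** * Zero components and UCF moves along them *)

Section ZeroComponents.
Variable g : {ffun 'I_n -> nat}.

Lemma zero_adj_sym : symmetric (zero_adj X g).
Proof.
by move=> i j; rewrite /zero_adj dynkin_sym; case: (g i == _); case: (g j == _).
Qed.

Lemma zero_component_closed S i j : zero_component X g S ->
  zero_adj X g i j -> (i \in S) = (j \in S).
Proof.
case=> k _ ->; rewrite !inE => ij; apply/idP/idP => /connect_trans; apply.
  exact: connect1.
by apply: connect1; rewrite zero_adj_sym.
Qed.

Lemma zero_component_zero S i : zero_component X g S -> i \in S -> g i = 0%N.
Proof.
case=> k gk ->; rewrite inE => /connectP[p + ->].
elim: p k gk => //= j p IHp k gk /andP[/and3P[_ /eqP gj _]].
exact: IHp.
Qed.

Lemma zero_component_adj S i j : zero_component X g S ->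
  i \in S -> j \notin S -> X i j -> (0 < g j)%N.
Proof.
move=> gS iS jS ij; rewrite lt0n; apply: contra jS => gj.
rewrite -(zero_component_closed gS (i := i)) // /zero_adj gj ij.
by rewrite (zero_component_zero gS iS) eqxx.
Qed.

Lemma zero_component_eq S S' i : zero_component X g S -> zero_component X g S' ->
  i \in S -> i \in S' -> S = S'.
Proof.
case=> k _ -> [k' _ ->]; rewrite !inE => ki k'i.
have /sym_connect_sym csym := zero_adj_sym.
by apply/finset.setP => j; rewrite !inE (same_connect csym ki) (same_connect csym k'i).
Qed.

Lemma highest_zero_component S c : highest S c ->
  (forall i, i \in S -> g i = 0%N) ->
  (forall i j, i \in S -> j \notin S -> X i j -> (0 < g j)%N) ->
  zero_component X g S.
Proof.
move=> /highest_connected[S0 S_conn] gS gNS.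
have [k kS] := finset.set0Pn _ S0; exists k; first exact: gS.
set C := [set j | connect (zero_adj X g) k j]%SET.
have CS : C \subset S.
  apply/fintype.subsetP => j; rewrite inE => kj.
  suff S_closed : closed (zero_adj X g) (mem S) by rewrite -(closed_connect S_closed kj).
  apply: (intro_closed (sym_connect_sym zero_adj_sym)) => x y /and3P[_ gy xy] xS.
  by apply: contraLR gy => yS; rewrite -lt0n (gNS x).
apply/esym/eqP; rewrite finset.eqEsubset CS /=; apply: contraT => SC.
have [||i [j [iC]]] := S_conn C.
- by rewrite properE CS.
- by apply/finset.set0Pn; exists k; rewrite inE connect0.
rewrite finset.in_setD => /andP[jC jS] ji; case/negP: jC.
have iS := fintype.subsetP CS _ iC; move: iC; rewrite !inE => ki.
by apply: connect_trans ki (connect1 _); rewrite /zero_adj !gS //= dynkin_sym.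
Qed.

End ZeroComponents.

Lemma highest_move S c g g' : highest S c -> zero_component X g S ->
  ucf_move X g S g' <-> lam g' = lam g + comb c.
Proof.
move=> cH gS; split=> [[_ [e /(highest_completion _ cH) eE g'E]]|g'E].
  apply: nip_alpha_inj => j; rewrite nipDl !nip_lam.
  have /(congr1 (fun k => k%:R : R)) := g'E j; rewrite !natrD eE.
  case: (boolP (j \in S)) => /= jS; first by rewrite addr0.
  by rewrite addr0 (highest_out cH jS) => <-; rewrite addrK.
split=> //; exists (fun i => if i \in S then Num.truncn (B (comb c) (alpha i)) else 0%N).
  apply/(highest_completion _ cH) => i; case: ifP => // iS.
  by rewrite truncnK // natrEint nip_comb_int; case: cH => _ _ ->.
move=> j; apply/eqP; rewrite -(eqr_nat R) !natrD -!nip_lam g'E nipDl.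
case: (boolP (j \in S)) => /= jS.
  by rewrite addr0 truncnK // natrEint nip_comb_int; case: cH => _ _ ->.
by rewrite (highest_out cH jS) addr0 subrK.
Qed.

(** Outside [S] a coordinate drops by 1 only next to [S], where [g] is positive. *)
Lemma highest_add_dominant S c g : highest S c -> zero_component X g S ->
  exists g', lam g' = lam g + comb c.
Proof.
move=> cH gS; have [|i|g' ->] := @lam_surj (lam g + comb c); last by exists g'.
  move=> j; rewrite nipDl nip_lam.
  have [jS|jS] := boolP (j \in S).
    by case: cH => _ _ c_dom; rewrite addr_ge0 ?ler0n ?c_dom.
  rewrite (highest_out cH jS) subr_ge0 ler_nat.
  case: existsP => // -[i /andP[iS ij]]; exact: (zero_component_adj gS iS jS ij).
by rewrite nipDl nip_lam rpredD ?natr_int ?nip_comb_int.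
Qed.


(** * Raising an orthogonal root to a highest root *)

(** Height is the pairing with the sum of the fundamental weights, bounded on the finite set [Phi];
    this makes the raising terminate. *)
Lemma height_bound : exists N, forall c, comb c \in Phi -> (\sum_i c i < N)%N.
Proof.
pose rho := \sum_i omega i.
have [N rhoN] : exists N : nat, forall a, a \in Phi -> B rho a < N%:R.
  exists (Num.bound (\sum_(a <- Phi) `|B rho a|)) => a aP.
  apply: le_lt_trans (le_trans (ler_norm _) _) (archi_boundP _); last first.
    by apply: sumr_ge0 => b _; apply: normr_ge0.
  by rewrite (big_rem a) //= lerDl; apply: sumr_ge0 => b _; apply: normr_ge0.
exists N => c /rhoN; rewrite nip_suml (eq_bigr (fun i => (c i)%:R)) => [|i _].
  by rewrite -natr_sum ltr_nat.
exact: nip_omega_comb.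
Qed.

(* Reflecting a root d orthogonal to lam g in simple roots orthogonal to lam g
   fixes lam g and increases d until d is the highest root of a zero component. *)
Lemma fire_to_highest g d : comb d \in Phi -> B (lam g) (comb d) = 0 ->
  exists S c, [/\ highest S c, zero_component X g S,
    forall i, (0 < d i)%N -> i \in S
    & exists t, lam g + comb c = word_act t (lam g + comb d)].
Proof.
have [N ltN] := height_bound.
have [M] := ubnP (N - \sum_i d i)%N; elim: M d => // M IHM d dM dP gd.
have [/existsP[i /andP[/eqP gi di]]|] :=
    boolP [exists i, (g i == 0%N) && (B (comb d) (alpha i) < 0)].
  have dNi : comb d != - alpha i.
    apply/eqP => /(congr1 (B (omega i))).
    rewrite nipNr nip_omega nip_omega_comb eqxx /=.
    by have := ler0n R (d i); lra.
  (* Hence the reflection in [alpha i] adds [alpha i] exactly once. *)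
  have di1 : B (comb d) (alpha i) = -1.
    apply/eqP; rewrite eq_le nip_root_geN1 ?alpha_in // andbT.
    by apply: (@int_lt_le _ (-1)); rewrite // nip_comb_int.
  have d'E : comb (fun j => d j + (j == i))%N = reflection ip (alpha i) (comb d).
    by rewrite comb_add reflectionE ?alpha_in // di1 scaleN1r opprK.
  have gi0 : B (lam g) (alpha i) = 0 by rewrite nip_lam gi.
  have d'P : comb (fun j => d j + (j == i))%N \in Phi.
    by rewrite d'E (root_reflection Phi_rs (alpha_in i) dP).
  have [| |S [c [cH gS dS [t tE]]]] := IHM _ _ d'P.
  - have := ltN _ d'P; have := dM; rewrite big_split /=.
    by rewrite (bigD1 i (F := fun j => _ (j == i))) //= eqxx; lia.
  - by rewrite comb_add nipDr gd gi0 addr0.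
  exists S, c; split=> // [j dj|]; first by apply: dS; rewrite ltn_addr.
  exists (rcons t i); rewrite tE -cats1 word_act_cat /= d'E; congr word_act.
  by rewrite reflectionD [in RHS](reflectionE (lam g)) ?alpha_in // gi0 scale0r subr0.
rewrite negb_exists => /forallP d_dom; pose S := [set i | (0 < d i)%N]%SET.
(* The pairing of [lam g] with [comb d] is a vanishing sum of nonnegative terms. *)
have gS i : i \in S -> g i = 0%N.
  rewrite inE => di; apply/eqP; move/eqP: gd.
  rewrite nipC nip_comb psumr_eq0 => [/allP/(_ i (mem_index_enum i))|j _].
    by rewrite mulf_eq0 nipC nip_lam !pnatr_eq0 gtn_eqF.
  by rewrite mulr_ge0 ?ler0n // nipC nip_lam ler0n.
have dH : highest S d.
  split=> // i; rewrite ?inE // => iS; rewrite leNgt.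
  by have := d_dom i; rewrite gS ?eqxx // inE.
exists S, d; split=> //; [|by move=> i; rewrite inE|by exists [::]].
apply: (highest_zero_component dH) => // i j iS jS ij; rewrite lt0n; apply/eqP => gj.
(* A neighbour of the support with [g j = 0] would pair to -1 with [comb d], so the raising could
   continue. *)
have := d_dom j; rewrite gj eqxx /= (highest_out dH jS) oppr_lt0.
by case: existsP => [|[]]; [rewrite ltr01|exists i; rewrite iS].
Qed.

Lemma fire_to_move g d : comb d \in Phi -> B (lam g) (comb d) = 0 ->
  exists S g', [/\ ucf_move X g S g', forall i, (0 < d i)%N -> i \in S
    & exists t, lam g' = word_act t (lam g + comb d)].
Proof.
move=> dP gd; have [S [c [cH gS dS [t tE]]]] := fire_to_highest dP gd.
have [g' g'E] := highest_add_dominant cH gS.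
exists S, g'; split=> //; first exact/(highest_move _ cH gS).
by exists t; rewrite g'E.
Qed.

Lemma ucf_move_highest g S g' : ucf_move X g S g' ->
  exists2 c, highest S c & lam g' = lam g + comb c.
Proof.
move=> gSg'; have [gS [e [T [b [/highest_numbering[c cH _] _]]] _]] := gSg'.
by exists c => //; apply/(highest_move _ cH gS).
Qed.

(** Whatever numbering is chosen, the move adds the same highest root. *)
Lemma ucf_move_inj g S g' g'' : ucf_move X g S g' -> ucf_move X g S g'' -> g' = g''.
Proof.
move=> gg' /ucf_move_highest[c cH cE]; apply: lam_inj; rewrite cE.
by have [gS _] := gg'; apply/(highest_move _ cH gS).
Qed.

Lemma nip_lam_highest g S c : zero_component X g S -> highest S c ->
  B (lam g) (comb c) = 0.
Proof.
move=> gS [_ cS _]; rewrite nipC nip_comb big1 // => i _.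
have [->|ci] := posnP (c i); first by rewrite mul0r.
by rewrite nipC nip_lam (zero_component_zero gS) ?mulr0 // cS.
Qed.

Lemma lam_word_inj t g h : lam g = word_act t (lam h) -> g = h.
Proof. by move/(dominant_unique (lam_dominant g) (lam_dominant h))/lam_inj. Qed.

Lemma ucf_move_firing g g' :
  (exists S, ucf_move X g S g') <->
  unlabeled_central_firing ip Phi alpha
    (weyl_orbit ip Phi (lam g)) (weyl_orbit ip Phi (lam g')).
Proof.
split=> [[S gSg']|].
  have [c cH g'E] := ucf_move_highest gSg'; have [cP _ _] := cH.
  exists (lam g), (lam g'); split; try exact: weyl_orbit_refl.
  split; [exact: lam_weight|exact: lam_weight|exists (comb c)].
  split=> //; first by split=> //; exists c.
  by rewrite ip_coroot // (nip_lam_highest (proj1 gSg')).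
move=> [u [v [/weyl_orbit_word[s uE] /weyl_orbit_word[s' vE]]]].
move=> [_ _ [a [[aP _] ua va]]].
rewrite ip_coroot // in ua.
(* The word [s] takes [lam g] to [u]; its inverse pulls the fired root back to one orthogonal to
   [lam g]. *)
set d := word_act (rev s) a; have dP : d \in Phi by exact: word_act_root.
have gd0 : B (lam g) d = 0 by rewrite -(word_actK s (lam g)) -uE word_act_nip.
have gdE : lam g + d = word_act (rev s ++ s') (lam g').
  by rewrite word_act_cat -vE va word_actD uE word_actK.
have [c [t [cP gc0 tE]]] : exists c t, [/\ comb c \in Phi, B (lam g) (comb c) = 0
    & lam g + comb c = word_act t (lam g')].
  case: (root_sign dP) => -[c dE].
    by exists c, (rev s ++ s'); rewrite -dE.
  (* For negative [d], the reflection in [d] takes [lam g + d] to [lam g - d], so the positive root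
     [- d] can be fired instead. *)
  have [t tE] := reflection_word dP.
  exists c, (t ++ rev s ++ s'); rewrite -dE rootN // nipNr gd0 oppr0; split=> //.
  rewrite word_act_cat -gdE -tE reflectionE // nipDl gd0 add0r nip_root //.
  by rewrite scaler_nat mulr2n opprD addrA addrK.
have [S [h [gSh _ [t' t'E]]]] := fire_to_move cP gc0.
exists S; rewrite tE -word_act_cat in t'E.
by rewrite -(lam_word_inj t'E).
Qed.

(* lam g1 + comb c2 = lam g2 + comb c1 is fired from both lam g1 and lam g2, and
   its orbit contains a single dominant weight. *)
Lemma ucf_move_commute g R1 R2 g1 g2 : R1 <> R2 ->
  ucf_move X g R1 g1 -> ucf_move X g R2 g2 ->
  exists R2' R1' h, [/\ ucf_move X g1 R2' h, R2 \subset R2',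
    ucf_move X g2 R1' h & R1 \subset R1'].
Proof.
move=> R12 gg1 gg2.
have [gR1 _] := gg1; have [gR2 _] := gg2.
have [c1 c1H g1E] := ucf_move_highest gg1.
have [c2 c2H g2E] := ucf_move_highest gg2.
(* Distinct zero components are disjoint and not adjacent, so their highest roots are orthogonal. *)
have ortho S S' c c' : zero_component X g S -> zero_component X g S' -> S <> S' ->
    highest S c -> highest S' c' -> B (lam g + comb c) (comb c') = 0.
  move=> gS gS' SS' cH c'H; rewrite nipDl (nip_lam_highest gS' c'H) add0r.
  have [_ c'S _] := c'H; rewrite nipC nip_comb big1 // => i _.
  have [->|] := posnP (c' i); first by rewrite mul0r.
  rewrite -c'S nipC => iS'.
  have iS : i \notin S by apply/negP => /(zero_component_eq gS gS')/(_ iS').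
  rewrite (highest_out cH iS); case: existsP => [[j /andP[jS ji]]|_].
    have := zero_component_adj gS jS iS ji.
    by rewrite (zero_component_zero gS' iS').
  by rewrite oppr0 mulr0.
have [c1P c1S _] := c1H; have [c2P c2S _] := c2H.
have [|R2' [h [g1h R2R [t tE]]]] := @fire_to_move g1 c2 c2P.
  by rewrite g1E (ortho _ _ _ _ gR1 gR2 R12).
have [|R1' [h' [g2h R1R [t' t'E]]]] := @fire_to_move g2 c1 c1P.
  by rewrite g2E; apply: (ortho _ _ _ _ gR2 gR1) => // /esym.
have hE : h = h'.
  (* One word followed by the inverse of the other passes through the common fired weight. *)
  apply: (@lam_word_inj (t ++ rev t')).
  by rewrite word_act_cat t'E word_actK tE g1E g2E addrAC.
exists R2', R1', h; rewrite {2}hE; split=> //; apply/fintype.subsetP => i.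
  by rewrite c2S => /R2R.
by rewrite c1S => /R1R.
Qed.

End Roots.

Theorem theorem5p7 (R : realType) (V : vectType R) (ip : {dot V for idfun})
  (Phi : {fset V}) (n : nat) (alpha omega : 'I_n -> V)
  (Phi_root_system : root_system ip Phi)
  (Phi_irreducible : irreducible_roots ip Phi)
  (Phi_simply_laced : simply_laced ip Phi)
  (alpha_simple : simple_roots Phi alpha)
  (omega_fundamental : fundamental_weights ip alpha omega) :
  let X := dynkin_diagram ip alpha in
  let lambda (g : {ffun 'I_n -> nat}) : V := \sum_(i < n) omega i *+ g i in
  (forall g g' : {ffun 'I_n -> nat},
     (exists S : {set 'I_n}, ucf_move X g S g') <->
     unlabeled_central_firing ip Phi alpha
       (weyl_orbit ip Phi (lambda g)) (weyl_orbit ip Phi (lambda g')))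
  /\
  (forall (g : {ffun 'I_n -> nat}) (R1 R2 : {set 'I_n})
          (g1 g2 : {ffun 'I_n -> nat}),
     zero_component X g R1 -> zero_component X g R2 -> R1 <> R2 ->
     ucf_move X g R1 g1 -> ucf_move X g R2 g2 ->
     exists R2' R1' : {set 'I_n},
       [/\ zero_component X g1 R2', R2 \subset R2',
           zero_component X g2 R1', R1 \subset R1'
         & exists h : {ffun 'I_n -> nat},
             (forall h', ucf_move X g1 R2' h' <-> h' = h) /\
             (forall h', ucf_move X g2 R1' h' <-> h' = h)]).
Proof.
(* Irreducibility provides the root [a0] that normalizes the inner product. *)
have [/fset0Pn[a0 a0P] _] := Phi_irreducible.
move=> X lambda; split=> [g g'|g R1 R2 g1 g2 gR1 gR2 R12 gg1 gg2].
  exact: (ucf_move_firing Phi_root_system Phi_simply_laced alpha_simple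
            omega_fundamental a0P).
have [R2' [R1' [h [g1h R2R g2h R1R]]]] :=
  ucf_move_commute Phi_root_system Phi_simply_laced alpha_simple
    omega_fundamental a0P R12 gg1 gg2.
exists R2', R1'; split=> //; [by case: g1h|by case: g2h|exists h].
have inj := ucf_move_inj Phi_root_system Phi_simply_laced alpha_simple
  omega_fundamental a0P.
by split=> h'; split=> [k|-> //]; apply: inj k _.
Qed.
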